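(* Let $\Omega\subset\mathbb{R}^n$ be a bounded convex domain and let $C_0\ge1$. Then, with $\alpha:=1/C_0$, $$\partial\Omega\cap B(x,C_0 d_\Omega(x))\subset\partial^{\mathrm{str}}_{x,\alpha}\Omega\qquad\text{for every }x\in\Omega .$$
   Context: A domain is a nonempty connected open set. $d_\Omega(y):=\operatorname{dist}(y,\partial\Omega)$; $B(y,r)$ is the open ball. For $x\ne\xi$, $[x,\xi):=\{(1-t)x+t\xi:0\le t<1\}$. For $x\in\Omega$ and $\alpha\in(0,1]$, $$\partial^{\mathrm{str}}_{x,\alpha}\Omega:=\bigl\{\xi\in\partial\Omega:\ [x,\xi)\subset\Omega\ \text{ and }\ d_\Omega((1-t)x+t\xi)\ge\alpha\min\{t,1-t\}|x-\xi|\ \text{ for every }t\in(0,1)\bigr\}.$$ *)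

(* Defs.v *)
From mathcomp Require Import all_boot all_order all_algebra.
From mathcomp Require Import all_classical all_reals all_analysis.

Set Implicit Arguments.
Unset Strict Implicit.
Unset Printing Implicit Defensive.

Import Order.TTheory GRing.Theory Num.Theory.
Import numFieldNormedType.Exports.

Local Open Scope classical_set_scope.
Local Open Scope ring_scope.

(* The library's norm on 'rV[R]_n is the sup norm.  Metric quantities (lengths,
   distances, balls) are therefore taken with respect to [enorm], whereas
   openness, closure, interior, connectedness and boundedness, which are the
   same for all norms on R^n, are the library's. *)
Definition enorm (R : realType) (n : nat) (u : 'rV[R]_n) : R :=
  Num.sqrt (\sum_(i < n) u ord0 i ^+ 2).

Definition eball (R : realType) (n : nat) (y : 'rV[R]_n) (r : R) :
    set 'rV[R]_n :=
  [set z | enorm (y - z) < r].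

Definition domain (T : topologicalType) (Omega : set T) : Prop :=
  [/\ Omega !=set0, connected Omega & open Omega].

Definition boundary (T : topologicalType) (A : set T) : set T :=
  closure A `\` interior A.

(* [inf] is 0 on the empty set; this only matters when the boundary of Omega is
   empty, which never happens for a nonempty bounded Omega in R^n with n > 0. *)
Definition bdist (R : realType) (n : nat) (Omega : set 'rV[R]_n)
    (y : 'rV[R]_n) : R :=
  inf [set enorm (y - z) | z in boundary Omega].

(* The half-open segment [x, xi). *)
Definition segment_co (R : realType) (n : nat) (x xi : 'rV[R]_n) :
    set 'rV[R]_n :=
  [set (1 - t) *: x + t *: xi | t in [set t : R | 0 <= t < 1]].

Definition str_boundary (R : realType) (n : nat) (Omega : set 'rV[R]_n)
    (x : 'rV[R]_n) (alpha : R) : set 'rV[R]_n :=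
  [set xi | [/\ boundary Omega xi,
                segment_co x xi `<=` Omega &
                forall t : R, 0 < t < 1 ->
                  alpha * Num.min t (1 - t) * enorm (x - xi)
                    <= bdist Omega ((1 - t) *: x + t *: xi)]].

(* Main.v *)
Require Import Defs.
From mathcomp Require Import all_boot all_order all_algebra.
From mathcomp Require Import all_classical all_reals all_analysis.

Set Implicit Arguments.
Unset Strict Implicit.
Unset Printing Implicit Defensive.

Import Order.TTheory GRing.Theory Num.Theory.
Import numFieldNormedType.Exports.

Local Open Scope classical_set_scope.
Local Open Scope ring_scope.

(** The homothety [p |-> (1 - t) p + t xi] centred at [xi], with ratio
    [1 - t], carries the ball [B(x, d(x))] onto the ball of radius
    [(1 - t) d(x)] about [w = (1 - t) x + t xi].  The first ball lies in Omega
    ([eball_bdist_sub]), so each point of the second is a convex combination of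
    a point of the open convex set Omega and a point [xi] of its closure, hence
    lies in Omega ([open_convex_combination]).  As Omega is open, it contains
    no boundary point, whence [d(w) >= (1 - t) d(x)] ([bdist_segment]).  The
    hypothesis [|x - xi| < C0 d(x)] turns this lower bound into
    [(1 - t) |x - xi| / C0], which dominates the required quantity since
    [min(t, 1 - t) <= 1 - t].  The inclusion of the segment [[x, xi)] in Omega
    is the same convex combination with [p = x]. *)

Lemma enormZ (R : realType) (n : nat) (a : R) (u : 'rV[R]_n) :
  enorm (a *: u) = `|a| * enorm u.
Proof.
rewrite /enorm -sqrtr_sqr -sqrtrM ?sqr_ge0// mulr_sumr.
by congr Num.sqrt; apply: eq_bigr => i _; rewrite mxE exprMn.
Qed.

Lemma convex_set_combination (R : realType) (V : lmodType R) (A : set V)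
    (p q : V) (t : R) :
  convex_set A -> A p -> A q -> 0 <= t <= 1 -> A ((1 - t) *: p + t *: q).
Proof.
move=> cA Ap Aq /andP[t0 t1].
have := cA q p (Itv01 t0 t1); rewrite !inE => /(_ Aq Ap).
by rewrite /conv /= addrC.
Qed.

Lemma open_boundary (T : topologicalType) (A : set T) (z : T) :
  open A -> boundary A z -> ~ A z.
Proof. by move=> /interior_id oA [_]; rewrite oA. Qed.

(** A combination [z] of [p] in [A] and [q] in [closure A] can be rewritten
    with a point [q'] of [A] close to [q] instead, at the price of moving [p]
    to [p + (t / (1 - t)) (q - q')]; openness of [A] at [p] absorbs this
    displacement. *)
Lemma open_convex_combination (R : realType) (V : normedModType R) (A : set V)
    (p q : V) (t : R) :
  open A -> convex_set A -> A p -> closure A q -> 0 <= t < 1 ->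
  A ((1 - t) *: p + t *: q).
Proof.
move=> oA cA Ap clq /andP[t0 t1].
have s0 : 1 - t != 0 by rewrite subr_eq0 eq_sym lt_eqF.
pose f (q' : V) : V := p + (t / (1 - t)) *: (q - q').
have fq : f q = p by rewrite /f subrr scaler0 addr0.
have cf : {for q, continuous f}.
  apply: cvgD; first exact: cvg_cst.
  by apply: cvgZ; [exact: cvg_cst|apply: cvgB]; [exact: cvg_cst|exact: cvg_id].
have /clq[q' [Aq' Afq']] : nbhs q (f @^-1` A).
  by apply: cf; rewrite fq; apply: open_nbhs_nbhs.
have -> : (1 - t) *: p + t *: q = (1 - t) *: f q' + t *: q'.
  rewrite /f scalerDr scalerA mulrCA divff// mulr1 scalerBr.
  by rewrite -!addrA addNr addr0.
by apply: convex_set_combination => //; rewrite t0 ltW.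
Qed.

(** If the segment missed the boundary, its intersection with [A] would be
    both open and closed in it, as [A] is open and agrees with [closure A]
    there; by connectedness it would be the whole segment. *)
Lemma segment_meets_boundary (R : realType) (V : normedModType R) (A : set V)
    (x p : V) :
  open A -> A x -> ~ A p ->
  exists2 t : R, 0 <= t <= 1 & boundary A (x + t *: (p - x)).
Proof.
move=> oA Ax nAp; apply: contrapT => nb.
pose f (t : R) : V := x + t *: (p - x).
have cf : continuous f.
  by move=> t; apply: cvgD; [exact: cvg_cst|apply: cvgZl; exact: cvg_id].
have S0 : (f @` `[0, 1]) x.
  by exists 0; rewrite /f ?scale0r ?addr0//= in_itv/= lexx ler01.
have S1 : (f @` `[0, 1]) p.
  by exists 1; rewrite /f ?scale1r ?subrKC//= in_itv/= lexx ler01.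
have connS : connected (f @` `[0, 1]).
  apply: connected_continuous_connected; first exact: segment_connected.
  exact: continuous_subspaceT.
apply: nAp; suff /seteqP[_ /(_ p S1)[]//] : f @` `[0, 1] `&` A = f @` `[0, 1].
apply: connS; [by exists x|by exists A|].
exists (closure A); first exact: closed_closure.
apply/seteqP; split=> z [Sz Az]; split=> //; first exact: subset_closure.
apply: contrapT => nAz; case: Sz => t; rewrite /= in_itv/= => t01 tz.
apply: nb; exists t => //; rewrite -/(f t) tz; split=> //.
by rewrite (interior_id _).1.
Qed.

Lemma bdist_le (R : realType) (n : nat) (A : set 'rV[R]_n) (x z : 'rV[R]_n) :
  boundary A z -> bdist A x <= enorm (x - z).
Proof.
move=> bz; apply: ge_inf; last by exists z.
by exists 0 => _ [w _ <-]; exact: sqrtr_ge0.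
Qed.

(** A segment from [x] to a point outside [A] would cross the boundary no
    farther from [x] than its endpoint. *)
Lemma eball_bdist_sub (R : realType) (n : nat) (A : set 'rV[R]_n)
    (x : 'rV[R]_n) :
  open A -> A x -> eball x (bdist A x) `<=` A.
Proof.
move=> oA Ax p /= xp; apply: contrapT => nAp.
have [t /andP[t0 t1] /bdist_le-/(_ x)] := segment_meets_boundary oA Ax nAp.
rewrite opprD addNKr -scalerN opprB enormZ ger0_norm// leNgt => /negP; apply.
by apply: le_lt_trans xp; rewrite ler_piMl// sqrtr_ge0.
Qed.

(** A boundary point within [(1 - t) d(x)] of [(1 - t) x + t xi] would be the
    image, under the homothety of ratio [1 - t] centred at [xi], of a point of
    the ball [B(x, d(x))]. *)
Lemma bdist_segment (R : realType) (n : nat) (A : set 'rV[R]_n)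
    (x xi : 'rV[R]_n) (t : R) :
  open A -> convex_set A -> A x -> boundary A xi -> 0 <= t < 1 ->
  (1 - t) * bdist A x <= bdist A ((1 - t) *: x + t *: xi).
Proof.
move=> oA cA Ax bxi t01; have /andP[t0 t1] := t01.
have s0 : 0 < 1 - t by rewrite subr_gt0.
apply: lb_le_inf; first by exists (enorm ((1 - t) *: x + t *: xi - xi)), xi.
move=> _ [z bz <-]; rewrite leNgt; apply/negP => wz.
apply: (open_boundary oA bz).
pose p := (1 - t)^-1 *: (z - t *: xi).
have zp : (1 - t) *: p + t *: xi = z.
  by rewrite /p scalerA divff ?gt_eqF// scale1r subrK.
rewrite -zp; apply: open_convex_combination => //; last exact: bxi.1.
apply: (eball_bdist_sub oA Ax); rewrite /eball/= -(ltr_pM2l s0).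
rewrite -[X in X * enorm _](gtr0_norm s0) -enormZ scalerBr.
by move: wz; rewrite -{1}zp opprD addrACA subrr addr0.
Qed.

Theorem proposition4p4 (R : realType) (n : nat) (Omega : set 'rV[R]_n) (C0 : R)
    (Omega_domain : domain Omega) (Omega_bounded : bounded_set Omega)
    (Omega_convex : convex_set Omega) (C0_ge1 : 1 <= C0) :
  forall x : 'rV[R]_n, Omega x ->
    boundary Omega `&` eball x (C0 * bdist Omega x)
      `<=` str_boundary Omega x (1 / C0).
Proof.
move=> x Ox xi [bxi /= xxi]; have [_ _ oO] := Omega_domain.
have C0gt0 : 0 < C0 by apply: lt_le_trans C0_ge1.
split=> // [_ [t /= t01 <-]|t /andP[t0 t1]].
  by apply: open_convex_combination => //; exact: bxi.1.
have t01 : 0 <= t < 1 by rewrite ltW.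
apply: le_trans (bdist_segment oO Omega_convex Ox bxi t01).
rewrite div1r mulrAC mulrC ler_pM//.
- by rewrite le_min ltW// subr_ge0 ltW.
- by rewrite mulr_ge0 ?invr_ge0 ?sqrtr_ge0// ltW.
- by rewrite ge_min lexx orbT.
- by rewrite ler_pdivrMl// ltW.
Qed.
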